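(* Let $Q$ be a strong commutative semicartesian quantale. The functor $\mathfrak{S}:\mathbf{QSet}_f\to\mathbf{ScottQSet}$ is left adjoint to the full inclusion functor $\mathbf{ScottQSet}\hookrightarrow\mathbf{QSet}_f$. In particular, for every $Q$-set $X$ and every Scott-complete $Q$-set $K$, $$\mathbf{QSet}_f(X,K)\cong\mathbf{QSet}_f(\mathfrak{S}(X),K).$$
   Context: A quantale is a complete lattice $(Q,\le)$ with an associative binary operation $\otimes$ that distributes over arbitrary suprema in each variable. It is commutative if $\otimes$ is commutative; semicartesian if $a\otimes b\le a\wedge b$ for all $a,b$; strong if for every $e\in Q$ with $e=e\otimes e$ and every $A\subseteq Q$, $e\le\bigvee_{a\in A}a$ implies $e\le\bigvee_{a\in A}a\otimes a$. A $Q$-set is a set $X$ with a map $\delta:X\times X\to Q$ such that for all $x,y,z$: $\delta(x,y)=\delta(y,x)$; $\delta(x,y)\otimes\delta(y,z)\le\delta(x,z)$; $\delta(x,x)\otimes\delta(x,y)=\delta(x,y)$. The extent of $x$ is $Ex:=\delta(x,x)$. $\mathbf{QSet}_f$ is the category of $Q$-sets with functional morphisms: functions $f:X\to Y$ with $\delta(x,x')\le\delta(f(x),f(x'))$ and $Ef(x)=Ex$, composed as functions. A singleton on $X$ is a map $\sigma:X\to Q$ such that for all $x,y\in X$: $\sigma(x)\otimes Ex=\sigma(x)$; $\sigma(x)\otimes\delta(x,y)\le\sigma(y)$; $\sigma(x)\otimes\sigma(y)\le\delta(x,y)$; $\sigma(x)\otimes\bigvee_{y\in X}\sigma(y)=\sigma(x)$.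 An element $x_\sigma\in X$ represents $\sigma$ if $\sigma(y)=\delta(y,x_\sigma)$ for all $y\in X$. $X$ is Scott-complete if every singleton on $X$ has exactly one representing element. $\mathbf{ScottQSet}$ is the full subcategory of $\mathbf{QSet}_f$ on Scott-complete $Q$-sets. $\mathfrak{S}(X)$ is the set of singletons on $X$ with $\delta(\sigma,\xi)=\bigvee_{x\in X}\sigma(x)\otimes\xi(x)$; for strong $Q$ this is a Scott-complete $Q$-set. For a functional morphism $f:X\to Y$, $\mathfrak{S}(f)(\xi)=\bigvee_{x\in X}\delta(f(x),-)\otimes\xi(x)$; this makes $\mathfrak{S}$ a functor $\mathbf{QSet}_f\to\mathbf{ScottQSet}$. *)

(* Defs.v *)
From HB Require Import structures.
From mathcomp Require Import all_boot all_order.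
From mathcomp Require Import boolp classical_sets.

Set Implicit Arguments.
Unset Strict Implicit.
Unset Printing Implicit Defensive.

Import Order.TTheory.

Declare Scope quantale_scope.
Delimit Scope quantale_scope with Qt.
Local Open Scope classical_set_scope.
Local Open Scope order_scope.
Local Open Scope quantale_scope.

HB.mixin Record Lattice_isComplete (d : Order.disp_t) T of Order.Lattice d T := {
  joins : set T -> T;
  joinsP : forall A : set T, supremums A (joins A)
}.

#[short(type="completeLatticeType")]
HB.structure Definition CompleteLattice (d : Order.disp_t) :=
  { T of Order.Lattice d T & Lattice_isComplete d T }.

(* The joins range over all subsets, the empty one included, so that
   tens \bot b = \bot = tens a \bot; no unit is required. *)
HB.mixin Record CompleteLattice_isQuantale (d : Order.disp_t) T
    of CompleteLattice d T := {
  tens : T -> T -> T;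
  tensA : associative tens;
  tens_joinsl : forall (A : set T) (b : T),
    tens (joins A) b = joins [set tens a b | a in A];
  tens_joinsr : forall (a : T) (B : set T),
    tens a (joins B) = joins [set tens a b | b in B]
}.

#[short(type="quantaleType")]
HB.structure Definition Quantale (d : Order.disp_t) :=
  { T of CompleteLattice d T & CompleteLattice_isQuantale d T }.

Notation "a ⊗ b" := (tens a b) (at level 40, left associativity)
  : quantale_scope.
Notation "⋁_ x F" := (joins (range (fun x => F)))
  (at level 41, x name, F at level 41, right associativity,
   format "⋁_ x  F") : quantale_scope.

Section QuantaleProperties.
Context {d : Order.disp_t} (Q : quantaleType d).

Definition semicartesian := forall a b : Q, a ⊗ b <= a `&` b.

Definition strong := forall (e : Q) (A : set Q),
  e = e ⊗ e -> e <= joins A -> e <= joins [set a ⊗ a | a in A].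

End QuantaleProperties.

Record category := Category {
  obj :> Type;
  hom : obj -> obj -> Type;
  idm : forall a, hom a a;
  compm : forall a b c, hom b c -> hom a b -> hom a c;
  compm1 : forall a b (f : hom a b), compm f (idm a) = f;
  comp1m : forall a b (f : hom a b), compm (idm b) f = f;
  compmA : forall a b c e (h : hom c e) (g : hom b c) (f : hom a b),
    compm h (compm g f) = compm (compm h g) f
}.
Arguments hom {c} _ _ : rename.
Arguments idm {c} a : rename.
Arguments compm {c a b c} g f : rename.

Record functor (C D : category) := Functor {
  fobj :> C -> D;
  fmap : forall a b : C, hom a b -> hom (fobj a) (fobj b);
  fmap1 : forall a : C, fmap (idm a) = idm (fobj a);
  fmapM : forall (a b c : C) (g : hom b c) (f : hom a b),
    fmap (compm g f) = compm (fmap g) (fmap f)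
}.
Arguments fmap {C D} F {a b} f : rename.

(* F -| G, as a family of bijections between hom-types natural in both
   variables. *)
Definition left_adjoint (C D : category) (F : functor C D) (G : functor D C) :=
  exists phi : forall (c : C) (e : D), hom (F c) e -> hom c (G e),
    [/\ forall c e, bijective (@phi c e),
        forall (c c' : C) (e : D) (f : hom c' c) (g : hom (F c) e),
          phi c' e (compm g (fmap F f)) = compm (phi c e g) f
      & forall (c : C) (e e' : D) (h : hom e e') (g : hom (F c) e),
          phi c e' (compm h g) = compm (fmap G h) (phi c e g)].

Section FullSubcategory.
Variables (C : category) (P : C -> Prop).

(* Morphisms are literally those of C, hence the inclusion acts on them as the
   identity. *)
Definition full_subcategory : category :=
  @Category {c : C | P c} (fun a b => hom (sval a) (sval b))
    (fun a => idm (sval a)) (fun a b c g f => compm g f)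
    (fun a b f => compm1 f) (fun a b f => comp1m f)
    (fun a b c e h g f => compmA h g f).

Definition full_inclusion : functor full_subcategory C :=
  @Functor full_subcategory C (fun a => sval a) (fun a b f => f)
    (fun a => erefl) (fun a b c g f => erefl).

End FullSubcategory.

Record qset (d : Order.disp_t) (Q : quantaleType d) := QSet {
  carrier :> Type;
  delta : carrier -> carrier -> Q;
  deltaC : forall x y, delta x y = delta y x;
  delta_trans : forall x y z, delta x y ⊗ delta y z <= delta x z;
  delta_extent : forall x y, delta x x ⊗ delta x y = delta x y
}.
Arguments delta {d Q q} x y : rename.

Definition extent (d : Order.disp_t) (Q : quantaleType d) (X : qset Q) (x : X)
  : Q := delta x x.

Record functional (d : Order.disp_t) (Q : quantaleType d) (X Y : qset Q) :=
  Functional {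
    ffun :> X -> Y;
    ffun_delta : forall x x', delta x x' <= delta (ffun x) (ffun x');
    ffun_extent : forall x, extent (ffun x) = extent x
  }.

Record singleton (d : Order.disp_t) (Q : quantaleType d) (X : qset Q) :=
  Singleton {
    sfun :> X -> Q;
    sing_extent : forall x, sfun x ⊗ extent x = sfun x;
    sing_delta : forall x y, sfun x ⊗ delta x y <= sfun y;
    sing_sing : forall x y, sfun x ⊗ sfun y <= delta x y;
    sing_joins : forall x, sfun x ⊗ (⋁_ y sfun y) = sfun x
  }.

Definition represents (d : Order.disp_t) (Q : quantaleType d) (X : qset Q)
  (x : X) (s : singleton X) := forall y, s y = delta y x.

Definition scott_complete (d : Order.disp_t) (Q : quantaleType d)
  (X : qset Q) := forall s : singleton X, exists! x, represents x s.

Section QSetCategory.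
Context {d : Order.disp_t} {Q : quantaleType d}.
Implicit Types X Y Z W : qset Q.

Lemma functional_eq X Y (f g : functional X Y) : f =1 g -> f = g.
Proof.
case: f g => [f f1 f2] [g g1 g2] /= /funext fg.
by subst g; congr Functional; exact: Prop_irrelevance.
Qed.

Lemma singleton_eq X (s t : singleton X) : s =1 t -> s = t.
Proof.
case: s t => [s s1 s2 s3 s4] [t t1 t2 t3 t4] /= /funext st.
by subst t; congr Singleton; exact: Prop_irrelevance.
Qed.

Definition functional_id X : functional X X :=
  @Functional d Q X X (fun x => x) (fun x x' => lexx _) (fun x => erefl).

Lemma functional_comp_delta X Y Z (g : functional Y Z) (f : functional X Y)
  x x' : delta x x' <= delta (g (f x)) (g (f x')).
Proof. exact: le_trans (ffun_delta f x x') (ffun_delta g _ _). Qed.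

Lemma functional_comp_extent X Y Z (g : functional Y Z) (f : functional X Y)
  x : extent (g (f x)) = extent x.
Proof. by rewrite !ffun_extent. Qed.

Definition functional_comp X Y Z (g : functional Y Z) (f : functional X Y) :
    functional X Z :=
  Functional (functional_comp_delta g f) (functional_comp_extent g f).

Lemma functional_comp1 X Y (f : functional X Y) :
  functional_comp f (functional_id X) = f.
Proof. exact: functional_eq. Qed.

Lemma functional_1comp X Y (f : functional X Y) :
  functional_comp (functional_id Y) f = f.
Proof. exact: functional_eq. Qed.

Lemma functional_compA X Y Z W (h : functional Z W) (g : functional Y Z)
    (f : functional X Y) :
  functional_comp h (functional_comp g f) =
  functional_comp (functional_comp h g) f.
Proof. exact: functional_eq. Qed.

End QSetCategory.

Definition QSet_f (d : Order.disp_t) (Q : quantaleType d) : category :=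
  @Category (qset Q) (@functional d Q) (@functional_id d Q)
    (@functional_comp d Q) (@functional_comp1 d Q) (@functional_1comp d Q)
    (@functional_compA d Q).

Definition ScottQSet (d : Order.disp_t) (Q : quantaleType d) : category :=
  full_subcategory (@scott_complete d Q : QSet_f Q -> Prop).

Definition Scott_inclusion (d : Order.disp_t) (Q : quantaleType d) :
    functor (ScottQSet Q) (QSet_f Q) :=
  full_inclusion (@scott_complete d Q : QSet_f Q -> Prop).

Section Joins.
Context {d : Order.disp_t} {Q : quantaleType d}.
Implicit Types a b c : Q.

Lemma joins_le I (f : I -> Q) b : (forall i, f i <= b) -> ⋁_ i f i <= b.
Proof. by move=> fb; apply: (joinsP _).2 => _ [i _ <-]. Qed.

Lemma le_joins I (f : I -> Q) i : f i <= ⋁_ i f i.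
Proof. by apply: (joinsP _).1; exists i. Qed.

Lemma eq_joins I (f g : I -> Q) : f =1 g -> ⋁_ i f i = ⋁_ i g i.
Proof. by move=> /funext ->. Qed.

Lemma tens_supl I (f : I -> Q) b : (⋁_ i f i) ⊗ b = ⋁_ i (f i ⊗ b).
Proof.
rewrite tens_joinsl; congr joins; apply/seteqP; split => [_ [_ [i _ <-] <-]|].
  by exists i.
by move=> _ [i _ <-]; exists (f i) => //; exists i.
Qed.

Lemma tens_supr I (f : I -> Q) a : a ⊗ (⋁_ i f i) = ⋁_ i (a ⊗ f i).
Proof.
rewrite tens_joinsr; congr joins; apply/seteqP; split => [_ [_ [i _ <-] <-]|].
  by exists i.
by move=> _ [i _ <-]; exists (f i) => //; exists i.
Qed.

Lemma joins_pair a b : a <= b -> joins [set a; b] = b.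
Proof.
move=> ab; apply/le_anti/andP; split.
  by apply: (joinsP _).2 => _ [->|->].
by apply: (joinsP _).1; right.
Qed.

Lemma le_tensl a b c : a <= b -> a ⊗ c <= b ⊗ c.
Proof.
move=> ab; rewrite -(joins_pair ab) tens_joinsl.
by apply: (joinsP _).1; exists a => //; left.
Qed.

Lemma le_tensr a b c : a <= b -> c ⊗ a <= c ⊗ b.
Proof.
move=> ab; rewrite -(joins_pair ab) tens_joinsr.
by apply: (joinsP _).1; exists a => //; left.
Qed.

Lemma le_tens a b a' b' : a <= a' -> b <= b' -> a ⊗ b <= a' ⊗ b'.
Proof. by move=> aa bb; exact: le_trans (le_tensl _ aa) (le_tensr _ bb). Qed.

Lemma semicart_l a b : semicartesian Q -> a ⊗ b <= a.
Proof. by move=> /(_ a b) /le_trans; apply; exact: leIl. Qed.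

Lemma semicart_r a b : semicartesian Q -> a ⊗ b <= b.
Proof. by move=> /(_ a b) /le_trans; apply; exact: leIr. Qed.

End Joins.

Section SingletonFunctor.
Context {d : Order.disp_t} {Q : quantaleType d}.
Hypotheses (Qcomm : commutative (@tens d Q)) (Qsc : semicartesian Q)
  (Qst : strong Q).
Implicit Types X Y Z : qset Q.

Let tensAC (a b c : Q) : a ⊗ b ⊗ c = a ⊗ c ⊗ b.
Proof. by rewrite -!tensA (Qcomm b). Qed.

Let tensACA (a b c e : Q) : a ⊗ b ⊗ (c ⊗ e) = (a ⊗ c) ⊗ (b ⊗ e).
Proof. by rewrite !tensA (tensAC a b c). Qed.

Lemma delta_extentr X (x y : X) : delta y x ⊗ extent x = delta y x.
Proof. by rewrite Qcomm deltaC delta_extent. Qed.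

Definition sing_dist X (s t : singleton X) : Q := ⋁_ x (s x ⊗ t x).

Lemma sing_distC X (s t : singleton X) : sing_dist s t = sing_dist t s.
Proof. by apply: eq_joins => x; rewrite Qcomm. Qed.

Lemma sing_dist_trans X (s t u : singleton X) :
  sing_dist s t ⊗ sing_dist t u <= sing_dist s u.
Proof.
rewrite /sing_dist tens_supl; apply: joins_le => x.
rewrite tens_supr; apply: joins_le => y.
apply: le_trans (le_joins _ y); rewrite -tensA (tensA (t x)) tensA.
apply: le_tensl; apply: le_trans (sing_delta s x y).
exact/le_tensr/sing_sing.
Qed.

(* The only use of strength: it makes the extent of a singleton its join. *)
Lemma sing_dist_ext X (s : singleton X) : sing_dist s s = ⋁_ x s x.
Proof.
apply/le_anti/andP; split.
  by apply: joins_le => x; apply: le_trans (le_joins _ x); exact: semicart_l.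
have /Qst /(_ (lexx _)) : (⋁_ x s x) = (⋁_ x s x) ⊗ (⋁_ x s x).
  by rewrite tens_supl; apply: eq_joins => x; rewrite sing_joins.
move=> /le_trans; apply; apply: (joinsP _).2 => _ [_ [x _ <-] <-].
exact: (le_joins (fun x => s x ⊗ s x) x).
Qed.

Lemma sing_dist_extent X (s t : singleton X) :
  sing_dist s s ⊗ sing_dist s t = sing_dist s t.
Proof.
rewrite sing_dist_ext [in LHS]/sing_dist tens_supr.
by apply: eq_joins => x; rewrite tensA (Qcomm _ (s x)) sing_joins.
Qed.

Definition singleton_qset X : qset Q :=
  QSet (@sing_distC X) (@sing_dist_trans X) (@sing_dist_extent X).

Section Representable.
Variables (X : qset Q) (x : X).

Lemma rsing_extent y : delta y x ⊗ extent y = delta y x.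
Proof. by rewrite Qcomm delta_extent. Qed.

Lemma rsing_delta y z : delta y x ⊗ delta y z <= delta z x.
Proof. by rewrite Qcomm (deltaC y z); exact: delta_trans. Qed.

Lemma rsing_sing y z : delta y x ⊗ delta z x <= delta y z.
Proof. by rewrite (deltaC z); exact: delta_trans. Qed.

Lemma rsing_joinsE : ⋁_ y delta y x = extent x.
Proof.
apply/le_anti/andP; split; last exact: (le_joins (fun y => delta y x) x).
by apply: joins_le => y; rewrite -delta_extentr; exact: semicart_r.
Qed.

Lemma rsing_joins y : delta y x ⊗ (⋁_ z delta z x) = delta y x.
Proof. by rewrite rsing_joinsE delta_extentr. Qed.

(* The singleton delta(-, x) represented by x. *)
Definition rsing : singleton X :=
  Singleton rsing_extent rsing_delta rsing_sing rsing_joins.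

Lemma rsing_dist (s : singleton X) : sing_dist s rsing = s x.
Proof.
apply/le_anti/andP; split.
  by apply: joins_le => y; exact: sing_delta.
by rewrite -[leLHS]sing_extent; exact: (le_joins (fun y => s y ⊗ delta y x)).
Qed.

End Representable.

Lemma rsing_delta2 X (x y : X) : sing_dist (rsing x) (rsing y) = delta x y.
Proof. by rewrite rsing_dist /= deltaC. Qed.

Section ScottCompletion.
Variables (X : qset Q) (S : singleton (singleton_qset X)).

Let s (x : X) : Q := S (rsing x).

Let s_extent x : s x ⊗ extent x = s x.
Proof.
by rewrite -[extent x]rsing_delta2 (sing_extent S (rsing x)).
Qed.

Let s_delta x y : s x ⊗ delta x y <= s y.
Proof.
by rewrite -[delta x y]rsing_delta2; exact: (sing_delta S (rsing x)).
Qed.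

Let s_sing x y : s x ⊗ s y <= delta x y.
Proof.
by rewrite -[delta x y]rsing_delta2; exact: (sing_sing S (rsing x)).
Qed.

Let s_joinsE : ⋁_ x s x = ⋁_ t S t.
Proof.
apply/le_anti/andP; split; apply: joins_le; [move=> x|move=> t].
  exact: (le_joins (fun t => S t) (rsing x)).
rewrite -(sing_extent S t) /extent /= sing_dist_ext tens_supr.
apply: joins_le => x; apply: le_trans (le_joins _ x).
by rewrite -(rsing_dist x t); exact: (sing_delta S t (rsing x)).
Qed.

Let s_joins x : s x ⊗ (⋁_ y s y) = s x.
Proof. by rewrite s_joinsE; exact: sing_joins. Qed.

Let sS : singleton X := Singleton s_extent s_delta s_sing s_joins.

Lemma sing_represented :
  exists! t : singleton_qset X, represents t S.
Proof.
exists sS; split => [t|t tS]; last first.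
  apply: singleton_eq => x /=.
  by rewrite /s (tS (rsing x)) /= sing_distC rsing_dist.
apply/le_anti/andP; split.
  rewrite -(sing_extent S t) /extent /= {2}/sing_dist tens_supr.
  apply: joins_le => x; apply: le_trans (le_joins _ x).
  rewrite tensA (Qcomm (t x)); apply: le_tensl.
  by rewrite -(rsing_dist x t); exact: (sing_delta S t (rsing x)).
apply: joins_le => x /=.
rewrite -(rsing_dist x t) sing_distC Qcomm.
exact: (sing_delta S (rsing x) t).
Qed.

End ScottCompletion.

Lemma singleton_qset_complete X : scott_complete (singleton_qset X).
Proof. move=> S; exact: sing_represented. Qed.

Section Map.
Variables (X Y : qset Q) (f : functional X Y).

Section Image.
Variable s : singleton X.

Definition sing_map_fun (y : Y) : Q := ⋁_ x (delta (f x) y ⊗ s x).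

Lemma sing_map_extent y : sing_map_fun y ⊗ extent y = sing_map_fun y.
Proof.
rewrite /sing_map_fun tens_supl; apply: eq_joins => x.
by rewrite tensAC delta_extentr.
Qed.

Lemma sing_map_delta y z : sing_map_fun y ⊗ delta y z <= sing_map_fun z.
Proof.
rewrite /sing_map_fun tens_supl; apply: joins_le => x.
apply: le_trans (le_joins _ x).
by rewrite tensAC; exact/le_tensl/delta_trans.
Qed.

Lemma sing_map_sing y z : sing_map_fun y ⊗ sing_map_fun z <= delta y z.
Proof.
rewrite /sing_map_fun tens_supl; apply: joins_le => x.
rewrite tens_supr; apply: joins_le => x'.
apply: (@le_trans _ _ (delta y (f x) ⊗ delta (f x) z)); last exact: delta_trans.
rewrite -tensA (deltaC (f x)); apply: le_tensr.
rewrite (Qcomm (delta _ _)) tensA; apply: le_trans (delta_trans _ (f x') _).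
exact: le_tensl (le_trans (sing_sing s x x') (ffun_delta f x x')).
Qed.

Lemma sing_map_joinsE : ⋁_ y sing_map_fun y = ⋁_ x s x.
Proof.
apply/le_anti/andP; split; apply: joins_le; [move=> y|move=> x].
  apply: joins_le => x; apply: le_trans (le_joins _ x); exact: semicart_r.
apply: le_trans (le_joins _ (f x)); apply: le_trans (le_joins _ x).
by rewrite -[delta _ _]/(extent _) ffun_extent Qcomm sing_extent.
Qed.

Lemma sing_map_joins y :
  sing_map_fun y ⊗ (⋁_ z sing_map_fun z) = sing_map_fun y.
Proof.
rewrite sing_map_joinsE [in LHS]/sing_map_fun tens_supl; apply: eq_joins => x.
by rewrite -tensA sing_joins.
Qed.

Definition sing_map : singleton Y :=
  Singleton sing_map_extent sing_map_delta sing_map_sing sing_map_joins.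

End Image.

Lemma le_sing_map (s : singleton X) x : s x <= sing_map s (f x).
Proof.
apply: le_trans (le_joins _ x).
by rewrite -[delta _ _]/(extent _) ffun_extent Qcomm sing_extent.
Qed.

Lemma sing_map_dist (s t : singleton_qset X) :
  delta s t <= delta (sing_map s : singleton_qset Y) (sing_map t).
Proof.
apply: joins_le => x; apply: le_trans (le_joins _ (f x)).
by apply: le_tens; exact: le_sing_map.
Qed.

Lemma sing_map_ext (s : singleton_qset X) :
  extent (sing_map s : singleton_qset Y) = extent s.
Proof. by rewrite /extent /= !sing_dist_ext sing_map_joinsE. Qed.

Definition singleton_map :
    functional (singleton_qset X) (singleton_qset Y) :=
  @Functional d Q (singleton_qset X) (singleton_qset Y) sing_map
    sing_map_dist sing_map_ext.

End Map.

Lemma singleton_map1 X :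
  singleton_map (functional_id X) = functional_id (singleton_qset X).
Proof.
apply: functional_eq => s; apply: singleton_eq => y /=.
rewrite -[RHS]rsing_dist.
by apply: eq_joins => x; rewrite Qcomm.
Qed.

Lemma singleton_mapM X Y Z (g : functional Y Z) (f : functional X Y) :
  singleton_map (functional_comp g f) =
  functional_comp (singleton_map g) (singleton_map f).
Proof.
apply: functional_eq => s; apply: singleton_eq => z /=.
apply/le_anti/andP; split; apply: joins_le; [move=> x /=|move=> y /=].
  apply: le_trans (le_joins _ (f x)); apply: le_tensr; exact: le_sing_map.
rewrite tens_supr; apply: joins_le => x; apply: le_trans (le_joins _ x) => /=.
rewrite tensA; apply: le_tensl; rewrite Qcomm.
exact: le_trans (le_tensl _ (ffun_delta g _ _)) (delta_trans _ _ _).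
Qed.

Definition singleton_functor : functor (QSet_f Q) (ScottQSet Q) :=
  @Functor (QSet_f Q) (ScottQSet Q)
    (fun X => exist _ (singleton_qset X) (@singleton_qset_complete X))
    singleton_map singleton_map1 singleton_mapM.

End SingletonFunctor.

(* Main.v *)
Require Import Defs.
From mathcomp Require Import all_boot all_order.
From mathcomp Require Import boolp classical_sets.

(** The unit of the adjunction sends a point [x] of [X] to the singleton
    [delta(-, x)] that it represents.  This map [sing_unit X] is isometric and
    natural in [X], and Scott-completeness of [K] says exactly that
    [sing_unit K] is bijective; write [sing_counit] for its inverse.  Hence a
    morphism [f : X -> K] extends along the unit to the composite of
    [singleton_map f] with the counit ([extendK]).

    The extension is unique because the completion is idempotent: applying
    [singleton_map] to the unit of [X] gives the unit of the completion of [X]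
    ([singleton_map_unit]).  For [g] out of the completion, naturality of the
    unit at [g] then gives
    [sing_unit K \o g = singleton_map g \o singleton_map (sing_unit X)
                      = singleton_map (g \o sing_unit X)],
    so [g] is the extension of its restriction to [X] ([unitK]).  Precomposition
    with the unit is thus a bijection, natural in [X] by naturality of the unit
    and in [K] by associativity. *)

Set Implicit Arguments.
Unset Strict Implicit.
Unset Printing Implicit Defensive.

Import Order.TTheory.
Local Open Scope order_scope.
Local Open Scope quantale_scope.

Section Reflection.
Context {d : Order.disp_t} {Q : quantaleType d}.
Hypotheses (Qcomm : commutative (@tens d Q)) (Qsc : semicartesian Q)
  (Qst : strong Q).
Implicit Types X Y K : qset Q.

Local Notation "'𝔖' X" := (singleton_qset Qcomm Qsc Qst X) (at level 9).
Local Notation smap := (singleton_map Qcomm Qsc Qst).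
Local Notation point := (@rsing _ _ Qcomm Qsc _).

Lemma representsE X (x : X) (s : singleton X) : represents x s <-> s = point x.
Proof. by split=> [xs|-> //]; exact: singleton_eq. Qed.

Lemma delta_point X (x y : X) : delta (point x : 𝔖 X) (point y) = delta x y.
Proof. exact: rsing_delta2. Qed.

Lemma point_delta X (x x' : X) :
  delta x x' <= delta (point x : 𝔖 X) (point x').
Proof. by rewrite delta_point. Qed.

Lemma point_extent X (x : X) : extent (point x : 𝔖 X) = extent x.
Proof. exact: delta_point. Qed.

Definition sing_unit X : functional X (𝔖 X) :=
  @Functional d Q X (𝔖 X) point (@point_delta X) (@point_extent X).

(** Both sides are [delta(-, f x)]: in the join defining the left side, the term
    at [x] already attains it, and the other terms stay below it by
    transitivity of [delta], since [f] does not decrease [delta]. *)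
Lemma sing_unit_nat X Y (f : functional X Y) :
  functional_comp (smap f) (sing_unit X) = functional_comp (sing_unit Y) f.
Proof.
apply: functional_eq => x; apply: singleton_eq => y /=.
rewrite /sing_map_fun; apply/le_anti/andP; split.
  apply: Defs.joins_le => x' /=; rewrite (deltaC (f x')).
  exact: le_trans (le_tensr _ (ffun_delta f _ _)) (delta_trans _ _ _).
rewrite deltaC; apply: le_trans (Defs.le_joins _ x) => /=.
by rewrite -[delta x x]/(extent x) -(ffun_extent f) Qcomm delta_extent.
Qed.

(** Both sides send [s] to [delta(-, s)], because the distance from a singleton
    [t] to the point [x] is the value [t x]. *)
Lemma singleton_map_unit X : smap (sing_unit X) = sing_unit (𝔖 X).
Proof.
apply: functional_eq => s; apply: singleton_eq => t /=.
by apply: Defs.eq_joins => x; rewrite /= sing_distC // rsing_dist.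
Qed.

Section Complete.
Variable K : qset Q.
Hypothesis Kc : scott_complete K.

Definition representative (s : 𝔖 K) : K := sval (cid (Kc s)).

Lemma point_representative (s : 𝔖 K) : point (representative s) = s.
Proof. by have [/representsE] := svalP (cid (Kc s)). Qed.

Lemma point_inj : injective (point : K -> 𝔖 K).
Proof.
move=> x y xy; have [z [_ zP]] := Kc (point x).
by transitivity z; [symmetry|]; apply: zP; apply/representsE.
Qed.

Lemma representative_delta (s t : 𝔖 K) :
  delta s t <= delta (representative s) (representative t).
Proof. by rewrite -[leRHS]delta_point !point_representative. Qed.

Lemma representative_extent (s : 𝔖 K) : extent (representative s) = extent s.
Proof. by rewrite -[LHS]point_extent point_representative. Qed.

Definition sing_counit : functional (𝔖 K) K :=
  Functional representative_delta representative_extent.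

Definition extend X (f : functional X K) : functional (𝔖 X) K :=
  functional_comp sing_counit (smap f).

Lemma extendK X :
  cancel (@extend X) (fun g => functional_comp g (sing_unit X)).
Proof.
move=> f; rewrite -functional_compA sing_unit_nat.
apply: functional_eq => x; apply: point_inj.
exact: point_representative.
Qed.

Lemma unitK X :
  cancel (fun g => functional_comp g (sing_unit X)) (@extend X).
Proof.
move=> g; apply: functional_eq => s; apply: point_inj.
rewrite [LHS]point_representative singleton_mapM singleton_map_unit.
by rewrite sing_unit_nat.
Qed.

End Complete.

End Reflection.

Theorem mainTheorem4 (d : Order.disp_t) (Q : quantaleType d)
    (Qcomm : commutative (@tens d Q)) (Qsc : semicartesian Q)
    (Qst : strong Q) :
  left_adjoint (singleton_functor Qcomm Qsc Qst) (Scott_inclusion Q) /\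
  forall (X K : qset Q), scott_complete K ->
    exists f : @hom (QSet_f Q) X K ->
               @hom (QSet_f Q) (singleton_qset Qcomm Qsc Qst X) K,
      bijective f.
Proof.
split; last first.
  move=> X K Kc; exists (@extend _ _ Qcomm Qsc Qst _ Kc X).
  by apply: Bijective; [exact: extendK|exact: unitK].
exists (fun (X : QSet_f Q) (K : ScottQSet Q) g =>
  functional_comp g (sing_unit Qcomm Qsc Qst X)); split.
- move=> X [K Kc].
  exact: (Bijective (@unitK _ _ Qcomm Qsc Qst _ Kc X)
                    (@extendK _ _ Qcomm Qsc Qst _ Kc X)).
- move=> X X' K f g /=.
  by rewrite -functional_compA sing_unit_nat functional_compA.
- by move=> X K K' h g /=; rewrite -functional_compA.
Qed.
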